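(* Let $d\in\mathbb{N}$, $p\in[-\infty,1)$, $q\in\mathbb{N}_0$, let $0\le k_0<\dots<k_q\le d$ be integers and let $K=K_{k_0,\dots,k_q}$ be the selection matrix for which $K^Tc$ is the vector of coefficients $\{c_{k_\ell}^m: m=-k_\ell,\dots,k_\ell;\ \ell=0,\dots,q\}$. Let $r\in\{d+1,\dots,2d\}$ and let $-1\le x_1<\dots<x_r\le1$, $w_1,\dots,w_r>0$ with $\sum w_i=1$ form a quadrature formula of degree $2d$, i.e. $\sum_{i=1}^rw_ix_i^\ell=\frac12\int_{-1}^1x^\ell dx$ for $\ell=0,\dots,2d$. Let $\mu$ be the design on $[0,\pi]$ putting mass $w_i$ at $\theta_i=\arccos x_i$, $i=1,\dots,r$. Let $t\ge 2d+1$ be an integer, $\alpha\in(-\frac{t+1}{t}\pi,-\pi]$, and let $\nu=\nu(\alpha,t)$ be the design on $(-\pi,\pi]$ putting mass $1/t$ at each $\phi_j=\alpha+\frac{2\pi j}{t}$, $j=1,\dots,t$. Then the product design $\mu\otimes\nu$ is $\Phi_p$-optimal for estimating $K^Tc$ in the spherical harmonic regression model of degree $d$, and it is $\Psi_{p,r'}$-optimal in this model for every $r'$ with $1\le r'\le (d+1)^2$.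
   Context: Spherical harmonic functions: for $n\in\mathbb{N}_0$, $Y_n^0(\theta,\phi)=\sqrt{2n+1}\,P_n(\cos\theta)$ with $P_n$ the $n$-th Legendre polynomial; for $1\le m\le n$, $Y_n^m(\theta,\phi)=\sqrt{2(2n+1)\frac{(n-m)!}{(n+m)!}}\,P_n^m(\cos\theta)\cos(m\phi)$ and $Y_n^{-m}(\theta,\phi)=\sqrt{2(2n+1)\frac{(n-m)!}{(n+m)!}}\,P_n^m(\cos\theta)\sin(m\phi)$, where $P_n^m(x)=(-1)^m(1-x^2)^{m/2}\frac{d^m}{dx^m}P_n(x)$; these are orthonormal w.r.t. $\frac{1}{4\pi}\sin\theta\,d\theta\,d\phi$ on $[0,\pi]\times(-\pi,\pi]$. The spherical harmonic regression model of degree $d$ is $E[Y\mid\theta,\phi]=c^Tf_d(\theta,\phi)$, $\mathrm{Var}[Y\mid\theta,\phi]=\sigma^2>0$, with $f_d=(Y_0^0,Y_1^{-1},Y_1^0,Y_1^1,\dots,Y_d^{-d},\dots,Y_d^d)^T\in\mathbb{R}^{(d+1)^2}$ and $c=(c_0^0,c_1^{-1},c_1^0,c_1^1,\dots,c_d^d)^T$. A design is a probability measure $\xi$ on $[0,\pi]\times(-\pi,\pi]$ with information matrix $M(\xi)=\int f_df_d^T\,d\xi$. For $K$ of rank $s$, $K^Tc$ is estimable under $\xi$ if $\mathrm{range}(K)\subset\mathrm{range}(M(\xi))$; then $C_K(\xi)=(K^TM^-(\xi)K)^{-1}$ and $\Phi_p(\xi)=(\mathrm{tr}\,C_K(\xi)^p)^{1/p}$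 ($p\ne0,-\infty$), $\Phi_0(\xi)=\det C_K(\xi)$, $\Phi_{-\infty}(\xi)=\lambda_{\min}(C_K(\xi))$; $\Phi_p$-optimal means maximizing $\Phi_p$ among designs under which $K^Tc$ is estimable. With $\lambda_{(j)}(M(\xi))$ the $j$-th smallest eigenvalue, $\Psi_{p,r'}(\xi)=(\sum_{j=1}^{r'}\lambda_{(j)}(M(\xi))^p)^{1/p}$ ($p\ne0,-\infty$), $\Psi_{0,r'}=\prod_{j=1}^{r'}\lambda_{(j)}$, $\Psi_{-\infty,r'}=\lambda_{(1)}$; $\Psi_{p,r'}$-optimal means maximizing $\Psi_{p,r'}$ over all designs. *)

(* Defs.v *)
From HB Require Import structures.
From mathcomp Require Import all_boot all_order all_algebra.
From mathcomp Require Import all_classical all_reals all_analysis.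
Set Implicit Arguments. Unset Strict Implicit. Unset Printing Implicit Defensive.
Import Order.TTheory GRing.Theory Num.Theory.
Local Open Scope classical_set_scope.
Local Open Scope ring_scope.

Section SH.
Variable R : realType.

(* Legendre polynomial P_n (Rodrigues' formula) *)
Definition legendre (n : nat) : {poly R} :=
  ((2 ^ n * n`!)%:R)^-1 *: (('X ^+ 2 - 1) ^+ n)^`(n).

Definition assoc_legendre (n m : nat) (x : R) : R :=
  (-1) ^+ m * (Num.sqrt (1 - x ^+ 2)) ^+ m * ((legendre n)^`(m)).[x].

Definition sh_const (n m : nat) : R :=
  Num.sqrt (2 * (2 * n%:R + 1) * ((n - m)`!)%:R / ((n + m)`!)%:R).

Definition sph_harm (n : nat) (m : int) (th ph : R) : R :=
  match m with
  | Posz 0 => Num.sqrt (2 * n%:R + 1) * (legendre n).[cos th]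
  | Posz m' => sh_const n m' * assoc_legendre n m' (cos th) * cos (m'%:R * ph)
  | Negz m' => sh_const n m'.+1 * assoc_legendre n m'.+1 (cos th)
                 * sin (m'.+1%:R * ph)
  end.

(* index i of f_d = (Y_0^0, Y_1^{-1}, Y_1^0, Y_1^1, ...) corresponds to (n,m)
   with n = floor(sqrt i), m = i - n^2 - n *)
Definition sh_deg (i : nat) : nat := (\max_(n < i.+1 | n * n <= i) n)%N.
Definition sh_ord (i : nat) : int :=
  (i%:Z - (sh_deg i * sh_deg i + sh_deg i)%:Z)%R.

Definition fvec (d : nat) (i : 'I_((d + 1) ^ 2)) (x : R * R) : R :=
  sph_harm (sh_deg i) (sh_ord i) x.1 x.2.

Definition design_space : set (R * R) :=
  [set x | 0 <= x.1 <= pi /\ - pi < x.2 <= pi].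

Definition is_design (P : probability (R * R)%type R) : Prop :=
  P design_space = 1%E.

Definition info_mx (d : nat) (P : probability (R * R)%type R)
  : 'M[R]_((d + 1) ^ 2) :=
  \matrix_(i, j) Rintegral P design_space (fun x => fvec i x * fvec j x).

Definition sel_idx (d : nat) (S : pred nat) : seq 'I_((d + 1) ^ 2) :=
  [seq i <- enum 'I_((d + 1) ^ 2) | S (sh_deg (nat_of_ord i))].

Definition sel_mx (d : nat) (S : pred nat)
  : 'M[R]_((d + 1) ^ 2, size (sel_idx d S)) :=
  \matrix_(i, j) (i == nth i (sel_idx d S) j)%:R.

Definition eigs (n : nat) (A : 'M[R]_n) : seq R :=
  sort <=%R (xget [::] [set s : seq R |
                        char_poly A = \prod_(z <- s) ('X - z%:P)]).

(* K^T c estimable under xi: range(K) in range(M(xi)) (column spaces) *)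
Definition estimable (n s : nat) (K : 'M[R]_(n, s)) (M : 'M[R]_n) : bool :=
  (K^T <= M^T)%MS.

Definition CK (n s : nat) (K : 'M[R]_(n, s)) (M : 'M[R]_n) : 'M[R]_s :=
  invmx (K^T *m pinvmx M *m K).

Definition Phi_crit (p : \bar R) (s : nat) (C : 'M[R]_s) : R :=
  match p with
  | -oo%E => head 0 (eigs C)
  | (p'%:E)%E => if p' == 0 then \det C
                 else powR (\sum_(z <- eigs C) powR z p') p'^-1
  | +oo%E => 0
  end.

(* Psi_{p,r'} of the information matrix: based on the r' smallest eigenvalues;
   for p < 0 and a vanishing eigenvalue the value is 0 (the limit) *)
Definition Psi_crit (p : \bar R) (r' n : nat) (M : 'M[R]_n) : R :=
  let l := take r' (eigs M) in
  match p with
  | -oo%E => head 0 l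
  | (p'%:E)%E => if p' == 0 then \prod_(z <- l) z
                 else if (p' < 0) && has (eq_op^~ 0) l then 0
                 else powR (\sum_(z <- l) powR z p') p'^-1
  | +oo%E => 0
  end.

Definition Phi_optimal (p : \bar R) (d : nat) (S : pred nat)
  (P : probability (R * R)%type R) : Prop :=
  is_design P /\ estimable (sel_mx d S) (info_mx d P) /\
  forall Q : probability (R * R)%type R, is_design Q ->
    estimable (sel_mx d S) (info_mx d Q) ->
    Phi_crit p (CK (sel_mx d S) (info_mx d Q))
      <= Phi_crit p (CK (sel_mx d S) (info_mx d P)).

Definition Psi_optimal (p : \bar R) (r' d : nat)
  (P : probability (R * R)%type R) : Prop :=
  is_design P /\
  forall Q : probability (R * R)%type R, is_design Q ->
    Psi_crit p r' (info_mx d Q) <= Psi_crit p r' (info_mx d P).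

End SH.

(* Main.v *)
(** Idea. The product design has the identity as information matrix, and every
    design [xi] satisfies, by the addition theorem [sum_m (Y_n^m)^2 = 2n+1],
    that the diagonal of [M(xi)] sums to [2n+1] over each degree [n], just as
    for the identity. The Gauss-Markov inequality
    [tr (K^T M^- K)^-1 <= tr (K^T M K)] and Chebyshev's inequality for the
    smallest eigenvalues then bound the relevant eigenvalues in mean by 1, and
    for [p < 1] the power mean is maximal when all of them equal 1.

    The addition theorem is proved by differentiation: by Legendre's equation
    the derivative of [sum_m (n-m)!/(n+m)! (1-x^2)^m (P_n^(m))^2] telescopes.
    The same equation integrated by parts gives the orthogonality relations,
    and the addition theorem then supplies the norms. *)
Require Import Defs.
From HB Require Import structures.
From mathcomp Require Import all_boot all_order all_algebra.
From mathcomp Require Import all_classical all_reals all_analysis.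
From mathcomp Require Import measurable_realfun complex zify ring lra.
Import Order.TTheory GRing.Theory Num.Theory.
Import numFieldNormedType.Exports.
Local Open Scope classical_set_scope.
Local Open Scope ring_scope.
Set Implicit Arguments. Unset Strict Implicit. Unset Printing Implicit Defensive.

(** * Eigenvalues and the optimality criteria *)

(** Over the complex closure the polynomial splits. For an eigenvector [v] with eigenvalue [z],
    evaluating [v A w^T] at the conjugate [w] of [v] in two ways gives [z N = conj z N], with [N]
    the squared norm of [v]; so every root is real. *)
Lemma sym_char_poly_split (R : rcfType) n (A : 'M[R]_n) : A^T = A ->
  exists s : seq R, char_poly A = \prod_(z <- s) ('X - z%:P).
Proof.
move=> symA; pose f := real_complex R.
have [r] := closed_field_poly_normal (char_poly (map_mx f A)).
rewrite (monicP (char_poly_monic _)) scale1r => rE.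
have real_r z : z \in r -> z = (complex.Re z)%:C%C.
  rewrite -root_prod_XsubC -rE -eigenvalue_root_char => /eigenvalueP[v vA v0].
  apply/esym/RRe_real/CrealP.
  pose w := map_mx Num.conj v; pose N := (v *m w^T) 0 0.
  have N0 : N != 0.
    apply: contra v0 => /eqP; rewrite /N mxE => N0; apply/eqP/rowP => j.
    have /psumr_eq0P : forall i : 'I_n, true -> 0 <= v 0 i * w^T i 0.
      by move=> i _; rewrite !mxE mul_conjC_ge0.
    move=> /(_ N0 j erefl) /eqP.
    by rewrite !mxE mul_conjC_eq0 => /eqP.
  have wA : w *m map_mx f A = z^* *: w.
    rewrite -map_mxZ -vA map_mxM; congr (_ *m _).
    by apply/matrixP => i j; rewrite !mxE; apply/esym/CrealP/complex_realP; exists (A i j).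
  have e : (v *m map_mx f A *m w^T) = (v *m (w *m map_mx f A)^T).
    by rewrite trmx_mul (map_trmx f A) symA mulmxA.
  move: e; rewrite vA wA linearZ /= -scalemxAl -scalemxAr => /matrixP/(_ 0 0).
  by rewrite [LHS]mxE [RHS]mxE -/N => /(mulIf N0) zz; exact: esym.
exists [seq complex.Re z | z <- r].
apply: (@map_inj_poly _ _ f _ _ ) => //; first exact: complexI.
rewrite map_char_poly rE rmorph_prod /= big_map big_seq [RHS]big_seq.
by apply: eq_bigr => z zr; rewrite rmorphB /= map_polyX map_polyC /= -real_r.
Qed.

Section Eigenvalues.
Variables (R : realType).

Definition psd n (A : 'M[R]_n) := forall v : 'rV[R]_n, 0 <= (v *m A *m v^T) 0 0.

(** [eigs] is a choice with default [[::]]; the existence of a real factorisation makes the chosen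
    list a genuine one, and sorting only permutes it. *)
Lemma eigs_char_poly n (A : 'M[R]_n) : A^T = A ->
  char_poly A = \prod_(z <- eigs A) ('X - z%:P).
Proof.
move=> /sym_char_poly_split As; rewrite /eigs.
set E := [set s : seq R | _]; have: E (xget [::] E).
  by have [s sE] := As; apply: (@xgetI _ [::] E s).
rewrite {1}/E /= => ->; apply: perm_big.
by rewrite perm_sym perm_sort.
Qed.

Lemma size_eigs n (A : 'M[R]_n) : A^T = A -> size (eigs A) = n.
Proof.
move=> /eigs_char_poly /(congr1 (size \o polyseq)) /=.
by rewrite size_char_poly size_prod_XsubC => -[].
Qed.

Lemma sum_eigs n (A : 'M[R]_n) : A^T = A -> \sum_(z <- eigs A) z = \tr A.
Proof.
move=> sA; have := size_eigs sA; have := eigs_char_poly sA.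
(* The trace is read off the coefficient just below the leading one, which the empty matrix
   lacks. *)
case: n A sA => [|n] A sA cE sE.
  by move/size0nil: sE => ->; rewrite big_nil /mxtrace big_ord0.
apply: oppr_inj; rewrite -char_poly_trace // cE -coefPn_prod_XsubC ?sE //.
Qed.

Lemma prod_eigs n (A : 'M[R]_n) : A^T = A -> \prod_(z <- eigs A) z = \det A.
Proof.
move=> sA; have := congr1 (fun p : {poly R} => p`_0) (eigs_char_poly sA).
rewrite char_poly_det coef0_prod_XsubC size_eigs // => /mulfI -> //.
by rewrite expf_neq0 // oppr_eq0 oner_eq0.
Qed.

Lemma eigs_eigenvalue n (A : 'M[R]_n) z : A^T = A ->
  z \in eigs A -> eigenvalue A z.
Proof.
by move=> sA; rewrite eigenvalue_root_char eigs_char_poly // root_prod_XsubC.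
Qed.

Lemma sqnorm_rV_ge0 n (v : 'rV[R]_n) : 0 <= (v *m v^T) 0 0.
Proof. by rewrite mxE sumr_ge0 // => i _; rewrite mxE -expr2 sqr_ge0. Qed.

Lemma sqnorm_rV_eq0 n (v : 'rV[R]_n) : (v *m v^T) 0 0 = 0 -> v = 0.
Proof.
have v0 i : true -> 0 <= v 0 i * v^T i 0 by rewrite mxE -expr2 sqr_ge0.
rewrite mxE => /(psumr_eq0P v0) vv; apply/rowP => j.
by have /eqP := vv j erefl; rewrite !mxE -expr2 sqrf_eq0 => /eqP.
Qed.

Lemma eigs_ge0 n (A : 'M[R]_n) z : A^T = A -> psd A -> z \in eigs A -> 0 <= z.
Proof.
move=> sA pA /(eigs_eigenvalue sA) /eigenvalueP[v vA v0].
have := pA v; rewrite vA -scalemxAl mxE pmulr_lge0 // lt_neqAle sqnorm_rV_ge0 andbT.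
by apply: contra v0 => /eqP/esym/sqnorm_rV_eq0 ->.
Qed.

Lemma eigs_neq0 n (A : 'M[R]_n) z : A^T = A -> A \in unitmx ->
  z \in eigs A -> z != 0.
Proof.
move=> sA uA /(eigs_eigenvalue sA) /eigenvalueP[v vA v0].
apply: contra v0 => /eqP z0; move: vA; rewrite z0 scale0r => vA.
by rewrite -(mulmxK uA v) vA mul0mx.
Qed.

Lemma eigs1 n : eigs (1%:M : 'M[R]_n) = nseq n 1.
Proof.
have s1 : (1%:M : 'M[R]_n)^T = 1%:M by rewrite trmx1.
rewrite -[in RHS](size_eigs s1).
apply/all_pred1P/allP => z /(eigs_eigenvalue s1) /eigenvalueP[v].
rewrite mulmx1 => vz v0 /=; have /eqP : (z - 1) *: v = 0.
  by rewrite scalerBl scale1r -vz subrr.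
by rewrite scaler_eq0 (negbTE v0) orbF subr_eq0.
Qed.

Lemma sorted_eigs n (A : 'M[R]_n) : sorted <=%R (eigs A).
Proof. by rewrite sort_sorted //; exact: le_total. Qed.

(** If the first [r] terms had a positive sum, the largest of them would exceed 1, hence so would
    all later entries, and the total would be positive. *)
Lemma sum_take_sorted (s : seq R) r : sorted <=%R s -> (r <= size s)%N ->
  \sum_(z <- s) (z - 1) <= 0 -> \sum_(z <- take r s) (z - 1) <= 0.
Proof.
move=> ss rs s0; rewrite leNgt; apply/negP => r0.
case: (leqP r 0) r0 => [|r0]; first by rewrite leqn0 => /eqP ->; rewrite take0 big_nil ltxx.
move=> h.
set a := nth 0 s r.-1.
have ndth i j : (i <= j)%N -> (j < size s)%N -> nth 0 s i <= nth 0 s j.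
  move=> ij js; apply: (sorted_leq_nth le_trans lexx) => //.
  by rewrite inE; apply: leq_ltn_trans js.
have a1 : \sum_(z <- take r s) (z - 1) <= \sum_(z <- take r s) (a - 1).
  rewrite (big_nth (0 : R)) [leRHS](big_nth (0 : R)) size_takel // ler_sum_nat // => i /andP[_ ir].
  by rewrite nth_take // lerD2r ndth ?prednK // -ltnS prednK.
have a0 : 0 < a - 1.
  have := lt_le_trans h a1; rewrite big_const_seq count_predT iter_addr_0.
  by rewrite pmulrn_lgt0 // size_takel.
move: s0; rewrite -{1}(cat_take_drop r s) big_cat /= leNgt => /negP; apply.
rewrite ltr_pwDl // (big_nth (0 : R)) big_nat sumr_ge0 // => i /andP[_].
rewrite size_drop nth_drop => ir; apply: (le_trans (ltW a0)).
rewrite lerD2r ndth //; last by rewrite -ltn_subRL.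
by rewrite (leq_trans (leq_pred r)) // leq_addr.
Qed.

(** Young's inequality for [z ^ p] and 1 with conjugate exponents [1/p] and [1/(1-p)]. *)
Lemma powR_le_bernoulli (z p : R) : 0 <= z -> 0 < p < 1 ->
  z `^ p <= 1 + p * (z - 1).
Proof.
move=> z0 /andP[p0 p1].
have h := @conjugate_powR R (z `^ p) 1 p^-1 (1 - p)^-1 (powR_ge0 _ _) ler01.
move: h; rewrite !invr_gt0 subr_gt0 p0 p1 !invrK => /(_ isT isT).
rewrite subrKC => /(_ erefl); rewrite mulr1 -powRrM mulfV ?gt_eqF //.
by rewrite powRr1 // powR1 mul1r => /le_trans; apply; lra.
Qed.

(** From [exp u >= 1 + u] at [u = p ln z], and [ln z <= z - 1], which multiplication by [p < 0]
    reverses. *)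
Lemma powR_ge_bernoulli (z p : R) : 0 < z -> p < 0 ->
  1 + p * (z - 1) <= z `^ p.
Proof.
move=> z0 p0; rewrite /powR gt_eqF //.
apply: (le_trans _ (expR_ge1Dx _)); rewrite lerD2l ler_nM2l //.
by rewrite -{1}(subrKC 1 z) le_ln1Dx //; lra.
Qed.

(** Not divided by the length: only lists of equal length are compared. *)
Definition pmean (p : R) (s : seq R) : R := (\sum_(z <- s) z `^ p) `^ p^-1.

(** Summing the Bernoulli bounds puts the power sum above the length if [p < 0] and below it if
    [p > 0]; the outer exponent [1/p] has the sign of [p], so both cases end in the same
    direction. *)
Lemma pmean_le (p : R) (s : seq R) : p < 1 -> p != 0 ->
  (forall z, z \in s -> 0 <= z) -> (p < 0 -> forall z, z \in s -> z != 0) ->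
  \sum_(z <- s) (z - 1) <= 0 -> pmean p s <= pmean p (nseq (size s) 1).
Proof.
move=> p1 p0 s0 sn0 sum0; rewrite /pmean.
have e1 : \sum_(z <- nseq (size s) 1) z `^ p = (size s)%:R.
  by rewrite big_nseq powR1 iter_addr_0.
have e2 : \sum_(z <- s) (1 + p * (z - 1)) = (size s)%:R + p * \sum_(z <- s) (z - 1).
  by rewrite big_split /= -mulr_sumr big_const_seq count_predT iter_addr_0.
rewrite e1; case: (ltgtP p 0) p0 => // hp _.
- have h : (size s)%:R <= \sum_(z <- s) z `^ p.
    apply: (@le_trans _ _ (\sum_(z <- s) (1 + p * (z - 1)))).
      by rewrite e2 lerDl mulr_le0 // ltW.
    rewrite big_seq [leRHS]big_seq ler_sum // => z zs.
    by rewrite powR_ge_bernoulli // lt_neqAle eq_sym sn0 // s0.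
  case: (posnP (size s)) h => [/size0nil -> _ | sz h]; first by rewrite big_nil.
  have sz0 : (0 : R) < (size s)%:R by rewrite ltr0n.
  (* A negative exponent is turned into the inverse of a positive power, which reverses the
     comparison. *)
  rewrite -[p^-1]opprK !(powRN _ (- p^-1)) lef_pV2 ?posrE ?powR_gt0 //.
    by rewrite ge0_ler_powR ?nnegrE ?oppr_ge0 ?invr_le0 ?ler0n ?(ltW hp) // (le_trans _ h).
  exact: lt_le_trans h.
- rewrite ge0_ler_powR ?nnegrE ?invr_ge0 ?ler0n ?(ltW hp) //.
    by rewrite sumr_ge0 // => z _; rewrite powR_ge0.
  apply: (@le_trans _ _ (\sum_(z <- s) (1 + p * (z - 1)))).
    rewrite big_seq [leRHS]big_seq ler_sum // => z zs.
    by rewrite powR_le_bernoulli ?s0 // hp.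
  by rewrite e2 gerDl mulr_ge0_le0 // ltW.
Qed.

(** Each factor is at most [exp (z - 1)], and these multiply to the exponential of the sum. *)
Lemma prod_le1_of_sum (s : seq R) : (forall z, z \in s -> 0 <= z) ->
  \sum_(z <- s) (z - 1) <= 0 -> \prod_(z <- s) z <= 1.
Proof.
move=> s0 sum0.
apply: (@le_trans _ _ (\prod_(z <- s) expR (z - 1))).
  rewrite big_seq [leRHS]big_seq ler_prod // => z zs; rewrite s0 //=.
  by apply: le_trans (expR_ge1Dx _); lra.
by rewrite -expR_sum -[leRHS]expR0 ler_expR.
Qed.

Lemma head_le1_of_sum (s : seq R) : sorted <=%R s -> (0 < size s)%N ->
  \sum_(z <- s) (z - 1) <= 0 -> head 0 s <= 1.
Proof.
move=> ss s0 /(sum_take_sorted ss s0).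
by case: s s0 {ss} => //= a s _; rewrite take0 big_seq1 subr_le0.
Qed.

Lemma sum_eigsB1 n (A : 'M[R]_n) : A^T = A ->
  \sum_(z <- eigs A) (z - 1) = \tr A - n%:R.
Proof.
move=> sA; rewrite sumrB sum_eigs // big_const_seq count_predT.
by rewrite iter_addr_0 size_eigs.
Qed.

(** The trace bound says that the eigenvalues have mean at most 1, while those of the identity all
    equal 1; product, power mean and minimum are then compared separately. *)
Lemma Phi_crit_le1 (p : \bar R) n (C : 'M[R]_n) : (p < 1%:E)%E ->
  C^T = C -> psd C -> C \in unitmx -> \tr C <= n%:R ->
  Phi_crit p C <= Phi_crit p (1%:M : 'M[R]_n).
Proof.
move=> p1 sC pC uC; rewrite -subr_le0 -sum_eigsB1 // => sum0.
have C0 z : z \in eigs C -> 0 <= z by exact: eigs_ge0.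
case: p p1 => [p||] p1; [rewrite lte_fin in p1|by rewrite ltNge leey in p1|].
- rewrite /=; case: eqP => [_|/eqP p0].
    by rewrite det1 -prod_eigs // prod_le1_of_sum.
  have := @pmean_le p (eigs C) p1 p0 C0 (fun _ z => @eigs_neq0 _ C z sC uC) sum0.
  by rewrite (size_eigs sC) (eigs1 n).
(* For the empty matrix both heads are the default 0. *)
- rewrite /=; case: (posnP n) => [n0|n0].
    have -> : eigs C = [::] by apply/size0nil; rewrite size_eigs.
    by rewrite eigs1 n0.
  rewrite eigs1; case: n n0 C {p1 pC uC} sC sum0 C0 => // n _ C sC sum0 C0 /=.
  by rewrite head_le1_of_sum ?sorted_eigs ?size_eigs.
Qed.

(** [sum_take_sorted] passes the bound on the mean to the [r] smallest eigenvalues; the rest is as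
    for [Phi_crit_le1]. *)
Lemma Psi_crit_le1 (p : \bar R) r n (M : 'M[R]_n) : (p < 1%:E)%E ->
  (0 < r <= n)%N -> M^T = M -> psd M -> \tr M <= n%:R ->
  Psi_crit p r M <= Psi_crit p r (1%:M : 'M[R]_n).
Proof.
move=> p1 /andP[r0 rn] sM pM; rewrite -subr_le0 -sum_eigsB1 // => sum0.
rewrite /Psi_crit eigs1 take_nseq //.
set l := take r (eigs M).
have szl : size l = r by rewrite size_takel // size_eigs.
have l0 z : z \in l -> 0 <= z by move=> /mem_take; exact: eigs_ge0.
have sl : sorted <=%R l by apply: take_sorted; exact: sorted_eigs.
have {}sum0 : \sum_(z <- l) (z - 1) <= 0.
  by rewrite sum_take_sorted ?sorted_eigs ?size_eigs.
case: p p1 => [p||] p1; [rewrite lte_fin in p1|by rewrite ltNge leey in p1|].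
- rewrite /=; case: eqP => [_|/eqP p0].
    by rewrite [leRHS]big_nseq iter_fix ?mulr1 // prod_le1_of_sum.
  have -> : has (eq_op^~ 0) (nseq r (1 : R)) = false.
    by rewrite has_nseq oner_eq0 andbF.
  (* [M] may be singular: for [p < 0] a vanishing eigenvalue gives the value 0, which is below any
     power. *)
  rewrite andbF; case: ifPn => [_|h]; first exact: powR_ge0.
  rewrite -szl; apply: (pmean_le p1 p0 l0 _ sum0) => pn z zl.
  by move: h; rewrite pn /= => /hasPn /(_ z zl).
- rewrite /= -[head 0 (nseq _ _)]nth0 nth_nseq r0.
  by rewrite head_le1_of_sum ?szl.
Qed.

(** * Semidefinite forms and the Gauss-Markov inequality *)

Lemma psd_mulmx m n (A : 'M[R]_n) (W : 'M[R]_(m, n)) :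
  psd A -> psd (W *m A *m W^T).
Proof. by move=> pA v; have := pA (v *m W); rewrite trmx_mul !mulmxA. Qed.

Lemma psd_tr n (A : 'M[R]_n) : psd A -> 0 <= \tr A.
Proof.
move=> pA; rewrite /mxtrace sumr_ge0 // => i _.
by have := pA (delta_mx 0 i); rewrite trmx_delta -rowE -colE !mxE.
Qed.

(** With [u = v A], [a = u u^T] and [b = u A u^T], the form at [v - c u] is [c^2 b - 2 c a], which
    would be negative for small [c > 0] unless [a = 0]. *)
Lemma psd_ker n (A : 'M[R]_n) (v : 'rV[R]_n) : A^T = A -> psd A ->
  (v *m A *m v^T) 0 0 = 0 -> v *m A = 0.
Proof.
move=> sA pA vAv; apply: sqnorm_rV_eq0.
set u := v *m A; pose a := (u *m u^T) 0 0; pose b := (u *m A *m u^T) 0 0.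
have a0 : 0 <= a by exact: sqnorm_rV_ge0.
have b0 : 0 <= b by exact: pA.
have uAv : (u *m A *m v^T) 0 0 = a.
  by rewrite /a /u -!mulmxA trmx_mul sA.
(* At [c = a / (b + 1)] the form is [- c^2 (b + 2)], which forces [c = 0]; the added 1 keeps the
   denominator positive when [b = 0]. *)
have aux (x y c : R) : 0 <= y -> c * (y + 1) = x ->
    0 <= 0 - c * x - (c * x - c * (c * y)) -> c = 0.
  move=> y0 <- h; apply/eqP; rewrite -sqrf_eq0 eq_le sqr_ge0 andbT.
  by have := mulr_ge0 (sqr_ge0 c) y0; have := sqr_ge0 c; nra.
have linE (W X Y Z : 'M[R]_1) c :
    (W - c *: X - (c *: Y - c *: (c *: Z))) 0 0 =
    W 0 0 - c * X 0 0 - (c * Y 0 0 - c * (c * Z 0 0)) by rewrite !mxE.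
have := pA (v - (a / (b + 1)) *: u).
have -> : (v - (a / (b + 1)) *: u)^T = v^T - (a / (b + 1)) *: u^T.
  by rewrite [LHS]linearB [X in _ - X]linearZ.
rewrite !(mulmxBl, mulmxBr) -!(scalemxAl, scalemxAr) linE -/a -/b.
rewrite vAv uAv => h.
have e : a / (b + 1) * (b + 1) = a by rewrite divfK // gt_eqF // ltr_wpDl.
by rewrite -e (aux _ _ _ b0 e h) mul0r.
Qed.

(* Gauss-Markov: [G := K^T - B^-1 Z^T] with [M Z = K] and [B = K^T M^- K]
   gives [0 <= G M G^T = K^T M K - B^-1]. *)
Lemma CK_spec n s (K : 'M[R]_(n, s)) (M : 'M[R]_n) :
  M^T = M -> psd M -> K^T *m K = 1%:M -> estimable K M ->
  [/\ (CK K M)^T = CK K M, psd (CK K M), CK K M \in unitmx &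
      \tr (CK K M) <= \tr (K^T *m M *m K)].
Proof.
move=> sM pM KK; rewrite /estimable sM => /submxP[Y KE].
have {Y KE} [Z KE] : exists Z, K = M *m Z.
  by exists Y^T; rewrite -[LHS]trmxK KE trmx_mul sM.
pose B := Z^T *m M *m Z.
have MpM : M *m pinvmx M *m M = M by rewrite mulmxKpV.
have BE : K^T *m pinvmx M *m K = B.
  move: (pinvmx M) MpM => X MXM; rewrite /B KE trmx_mul sM.
  by rewrite -!mulmxA (mulmxA M X) (mulmxA (M *m X)) MXM.
have sB : B^T = B by rewrite /B !trmx_mul trmxK sM mulmxA.
have pB : psd B.
  by have := psd_mulmx Z^T pM; rewrite trmxK.
(* If [v B = 0], the form of [M] vanishes at [v Z^T], so [v Z^T M = v K^T] is 0, and [K^T K = 1]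
   gives [v = 0]. *)
have uB : B \in unitmx.
  rewrite -row_free_unit -kermx_eq0; apply/rowV0P => v /sub_kermxP vB.
  have v0 : v *m Z^T *m M = 0.
    apply: psd_ker => //; have -> : v *m Z^T *m M *m (v *m Z^T)^T = v *m B *m v^T.
      by rewrite trmx_mul trmxK /B !mulmxA.
    by rewrite vB mul0mx mxE.
  have: v *m K^T = 0 by rewrite KE trmx_mul sM mulmxA.
  by move=> /(congr1 (mulmx^~ K)); rewrite -mulmxA KK mulmx1 mul0mx.
rewrite /CK BE; split.
- by rewrite trmx_inv sB.
- have := psd_mulmx (invmx B) pB; by rewrite trmx_inv sB mulVmx // mul1mx.
- by rewrite unitmx_inv.
- pose G := K^T - invmx B *m Z^T.
  have := psd_tr (psd_mulmx G pM).
  have ZM : Z^T *m M = K^T by rewrite KE trmx_mul sM.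
  have MZ : M *m Z = K by rewrite KE.
  have KZ : K^T *m Z = B by rewrite -ZM.
  have -> : G *m M *m G^T = K^T *m M *m K - invmx B.
    have -> : G^T = K - Z *m invmx B.
      by rewrite [LHS]linearB /= trmx_mul !trmxK trmx_inv sB.
    rewrite /G mulmxBl mulmxBr -(mulmxA _ _ M) ZM !mulmxBl.
    rewrite (mulmxA (K^T *m M)) -(mulmxA K^T M Z) MZ KK mul1mx.
    rewrite -(mulmxA (invmx B) _ K) KK mulmx1 (mulmxA (invmx B *m _)) -(mulmxA _ K^T Z).
    by rewrite KZ mulVmx // mul1mx subrr subr0.
  by rewrite linearB /= subr_ge0.
Qed.
End Eigenvalues.

(** * Legendre functions *)

Section Legendre.
Variable R : realType.
Implicit Types (p q : {poly R}) (n m j : nat).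

Lemma size_derivn_leq p m : (size p^`(m) <= size p - m)%N.
Proof.
apply/leq_sizeP => j hj; rewrite coef_derivn nth_default ?mul0rn //.
by rewrite -leq_subLR.
Qed.

Lemma deriv_one : (1 : {poly R})^`() = 0.
Proof. by rewrite -polyC1 derivC. Qed.

(** Derives [a = b] from a known [c = e], leaving [a - b = c - e] to [ring]. *)
Lemma eq_sub_eq (V : zmodType) (a b c e : V) : c = e -> a - b = c - e -> a = b.
Proof. by move=> ->; rewrite subrr => /eqP; rewrite subr_eq0 => /eqP. Qed.

Lemma deriv_natr n : (n%:R : {poly R})^`() = 0.
Proof. by rewrite -polyC_natr derivC. Qed.

(** The constant is named by the value at 1, where Legendre polynomials are normalised and positive
    powers of [U] vanish. *)
Lemma deriv_eq0 p : p^`() = 0 -> p = (p.[1])%:P.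
Proof.
move=> p'0; have pE : p = (p`_0)%:P.
  apply/polyP => -[|i]; rewrite coefC //=.
  have /eqP := congr1 (fun q : {poly R} => q`_i) p'0.
  by rewrite coef_deriv coef0 mulrn_eq0 /= => /eqP.
by rewrite [in RHS]pE hornerC.
Qed.

(** [w] is the base in Rodrigues' formula; [U = - w] is the weight, the square of [sin theta] at
    [x = cos theta]. *)
Let w : {poly R} := 'X ^+ 2 - 1.
Let U : {poly R} := 1 - 'X ^+ 2.

Lemma horner_U z m : z ^+ 2 = 1 -> (U ^+ m.+1).[z] = 0.
Proof.
by move=> z1; rewrite horner_exp /U hornerD hornerN hornerXn z1 hornerC subrr expr0n.
Qed.

Lemma deriv_w : w^`() = 2%:R * 'X.
Proof. by rewrite /w derivB derivXn deriv_one /= subr0 mulr_natl. Qed.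

(** This is [w v' = 2 n X v] differentiated [j + 1] times. *)
Lemma rodrigues_ode n j : let v := w ^+ n in
  w * v^`(j.+2) + 2%:R * (j%:R + 1 - n%:R) * 'X * v^`(j.+1) =
  (j%:R + 1) * (2%:R * n%:R - j%:R) * v^`(j).
Proof.
move=> v.
have v1 : w * v^`() = 2%:R * n%:R * 'X * v.
  rewrite /v; case: n @v => [|n] _.
    by rewrite expr0 deriv_one mulr0 mulr0 !mul0r.
  by rewrite deriv_exp deriv_w -mulr_natl exprS /=; ring.
elim: j => [|j IH].
  have := congr1 (@deriv R) v1.
  rewrite derivM deriv_w !derivM !deriv_natr derivX => h.
  by apply: (eq_sub_eq h); rewrite /derivn /=; ring.
have := congr1 (@deriv R) IH.
rewrite !(derivD, derivB, derivN, derivM, deriv_natr, deriv_w, derivX, deriv_one) -!derivnS => h.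
apply: (eq_sub_eq h).
move: v^`(j.+3) v^`(j.+2) v^`(j.+1) v^`(j) => a b c e.
by rewrite -[in j.+1%:R]natr1; ring.
Qed.

(** At 1 only the term survives in which every derivative falls on the power; a general cofactor [g]
    lets the induction absorb what one derivative leaves behind. *)
Lemma deriv_XsubC1_exp n (g : {poly R}) :
  ((('X - 1) ^+ n * g)^`(n)).[1] = (n`!)%:R * g.[1].
Proof.
elim: n g => [|n IH] g; first by rewrite derivn0 expr0 !mul1r.
rewrite derivSn derivM deriv_exp derivB derivX deriv_one subr0 mul1r.
rewrite /= -mulr_natl.
have -> : n.+1%:R * ('X - 1) ^+ n * g + ('X - 1) ^+ n.+1 * g^`() =
   ('X - 1) ^+ n * (n.+1%:R * g + ('X - 1) * g^`()) :> {poly R} by rewrite exprS; ring.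
rewrite IH hornerD !hornerM -polyC_natr hornerC hornerD hornerN hornerX hornerC.
by rewrite subrr mul0r addr0 factS natrM; ring.
Qed.

Lemma legendre1 n : (legendre R n).[1] = 1.
Proof.
rewrite /legendre hornerZ.
have -> : ('X ^+ 2 - 1 : {poly R}) ^+ n = ('X - 1) ^+ n * ('X + 1) ^+ n.
  by rewrite -exprMn; congr (_ ^+ _); ring.
rewrite deriv_XsubC1_exp horner_exp hornerD hornerX hornerC.
rewrite -[1 + 1]/(2%:R) -natrX -natrM mulnC mulVf // pnatr_eq0 muln_eq0 negb_or expn_eq0 /=.
Qed.

(** The associated Legendre function without sign and square root, so that the calculus stays
    polynomial. *)
Definition dlegendre n m := (legendre R n)^`(m).
Local Notation y := dlegendre.

Lemma dlegendreS n m : y n m.+1 = (y n m)^`().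
Proof. by rewrite /dlegendre derivnS. Qed.

(** Equal to [(n - m) (n + m + 1)]. *)
Definition legendre_eig n m : R := n%:R * (n%:R + 1) - m%:R * (m%:R + 1).

(** Legendre's equation differentiated [m] times, in Sturm-Liouville form: [rodrigues_ode] at
    [j = n + m], multiplied by [- c U^m]. *)
Lemma legendre_ode n m :
  (U ^+ m.+1 * y n m.+1)^`() = - (legendre_eig n m)%:P * (U ^+ m * y n m).
Proof.
have h := rodrigues_ode n (n + m).
set c := (((2 ^ n * n`!)%:R : R)^-1)%:P.
have yE k : y n k = c * (w ^+ n)^`(n + k).
  by rewrite /dlegendre /legendre derivnZ -mul_polyC /derivn -iterD addnC.
have U1 : U^`() = - (2%:R * 'X).
  by rewrite /U derivB derivXn deriv_one /= sub0r mulr_natl.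
rewrite derivM deriv_exp U1 -mulr_natl -dlegendreS !yE !addnS exprS succnK.
move: h; rewrite /=.
move: ((w ^+ n)^`((n + m).+2)) ((w ^+ n)^`((n + m).+1)) ((w ^+ n)^`(n + m)) => a b e h.
have -> : (legendre_eig n m)%:P = n%:R * (n%:R + 1) - m%:R * (m%:R + 1) :> {poly R}.
  by rewrite /legendre_eig polyCB !polyCM !polyCD !polyC_natr.
apply: (eq_sub_eq (congr1 (fun z => - c * U ^+ m * z) h)).
by rewrite /U /w -[in m.+1%:R]natr1 natrD; ring.
Qed.


Lemma size_legendre n : (size (legendre R n) <= n.+1)%N.
Proof.
apply: leq_trans (size_scale_leq _ _) _; apply: leq_trans (size_derivn_leq _ _) _.
have : (size (w ^+ n) <= (2 * n).+1)%N.
  apply: leq_trans (size_poly_exp_leq _ _) _.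
  by rewrite /w -polyC1 size_XnsubC //=.
by move=> h; rewrite leq_subLR (leq_trans h) //; lia.
Qed.

Lemma size_dlegendre n m : (size (y n m) <= n.+1 - m)%N.
Proof.
apply: leq_trans (size_derivn_leq _ _) _.
by rewrite leq_sub2r // size_legendre.
Qed.

Lemma dlegendre_gt n m : (n < m)%N -> y n m = 0.
Proof.
move=> nm; apply/eqP; rewrite -size_poly_leq0; apply: leq_trans (size_dlegendre _ _) _.
by rewrite leqn0 subn_eq0.
Qed.

Definition legendre_ratio n m : R := ((n - m)`!)%:R / ((n + m)`!)%:R.

(** The factors [n - m] and [n + m + 1] of the eigenvalue are those by which consecutive factorials
    differ. *)
Lemma legendre_ratioS n m : (m < n)%N ->
  legendre_ratio n m.+1 * legendre_eig n m = legendre_ratio n m.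
Proof.
move=> mn; rewrite /legendre_ratio /legendre_eig.
have -> : (n - m = (n - m.+1).+1)%N by lia.
rewrite addnS !factS !natrM.
have -> : (n - m.+1).+1%:R = n%:R - m%:R :> R by rewrite -natrB ?(ltnW mn) //; congr _%:R; lia.
rewrite -natr1 natrD.
field.
rewrite pnatr_eq0 -lt0n fact_gt0 /= -natrD natr1 pnatr_eq0 //.
Qed.

Lemma unsold n :
  y n 0 ^+ 2 + 2%:R * \sum_(m < n) (legendre_ratio n m.+1)%:P *
    (U ^+ m.+1 * y n m.+1 ^+ 2) = 1.
Proof.
(* By [legendre_ode] the [m]-th summand has derivative [T (m+1) - T m]. The sum telescopes to
   [- T 0], and twice this cancels the derivative of [y n 0 ^ 2]. *)
set G := (LHS); pose T m := (legendre_ratio n m)%:P * (U ^+ m * (y n m * y n m.+1)).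
have G' : G^`() = 0.
  rewrite /G derivD derivM deriv_natr mul0r add0r expr2 derivM -!dlegendreS.
  have -> : (\sum_(m < n) (legendre_ratio n m.+1)%:P * (U ^+ m.+1 * y n m.+1 ^+ 2))^`() =
      \sum_(m < n) (T m.+1 - T m).
    rewrite raddf_sum; apply: eq_bigr => -[m mn] _ /=.
    rewrite derivM derivC mul0r add0r expr2 mulrA derivM legendre_ode.
    rewrite -(dlegendreS n m.+1) /T -(legendre_ratioS mn) [(_ * legendre_eig _ _)%:P]polyCM.
    ring.
  rewrite -(big_mkord xpredT (fun m => T m.+1 - T m)) telescope_sumr //.
  have -> : T n = 0 by rewrite /T (@dlegendre_gt n n.+1) // !mulr0.
  rewrite sub0r /T /legendre_ratio subn0 addn0 mulfV.
    by rewrite expr0 -/(y n 1); ring.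
  by rewrite pnatr_eq0 -lt0n fact_gt0.
(* At 1 only [y n 0], which is 1 there, contributes. *)
rewrite (deriv_eq0 G') /G hornerD horner_exp legendre1 expr1n hornerM horner_sum.
rewrite big1 ?mulr0 ?addr0 // => m _.
by rewrite !hornerM horner_U ?expr1n // mul0r mulr0.
Qed.

(** * Orthogonality of Legendre functions under a quadrature rule *)

Section Quadrature.
Variables (r : nat) (wt x : 'I_r -> R).

Definition quad p : R := \sum_i wt i * p.[x i].

Lemma quadD p q : quad (p + q) = quad p + quad q.
Proof. by rewrite /quad -big_split; apply: eq_bigr => i _; rewrite hornerD mulrDr. Qed.

Lemma quadZ c p : quad (c%:P * p) = c * quad p.
Proof.
by rewrite /quad mulr_sumr; apply: eq_bigr => i _; rewrite hornerM hornerC mulrCA.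
Qed.

Lemma quad_sum (I : Type) (s : seq I) (F : I -> {poly R}) :
  quad (\sum_(i <- s) F i) = \sum_(i <- s) quad (F i).
Proof.
by elim/big_rec2: _ => [|i _ p _ <-]; rewrite ?quadD // /quad big1 // => i _; rewrite horner0 mulr0.
Qed.

Variable d : nat.
(** Exactness up to degree [2d], phrased by antiderivatives: [q] has degree at most [2d + 1], and
    its endpoint values replace the integral. *)
Hypothesis quad_deriv : forall q, (size q <= 2 * d + 2)%N ->
  quad q^`() = 2^-1 * (q.[1] - q.[-1]).

(** The polynomial [q] vanishes at both endpoints, so the rule annihilates its derivative, which the
    product rule and [legendre_ode] expand. *)
Lemma quad_by_parts n n' m : (n <= d)%N -> (n' <= d)%N ->
  quad (U ^+ m.+1 * (y n m.+1 * y n' m.+1)) =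
  legendre_eig n m * quad (U ^+ m * (y n m * y n' m)).
Proof.
move=> nd nd'; set q := U ^+ m.+1 * y n m.+1 * y n' m.
(* The degree is at most [2(m+1) + (n-m-1) + (n'-m) = n + n' + 1]; zero factors are set apart
   because the size bounds truncate. *)
have sq : (size q <= 2 * d + 2)%N.
  have := size_dlegendre n m.+1; have := size_dlegendre n' m.
  rewrite /q; have [->|yn0] := eqVneq (y n m.+1) 0; first by rewrite mulr0 mul0r size_poly0.
  have [->|yn0'] := eqVneq (y n' m) 0; first by rewrite mulr0 size_poly0.
  move=> s1 s2.
  have : (size (U ^+ m.+1) <= (2 * m.+1).+1)%N.
    apply: leq_trans (size_poly_exp_leq _ _) _.
    by rewrite /U -opprB size_polyN -polyC1 size_XnsubC.
  have := size_polyMleq (U ^+ m.+1 * y n m.+1) (y n' m).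
  have := size_polyMleq (U ^+ m.+1) (y n m.+1).
  move: yn0 yn0'; rewrite -!size_poly_gt0; lia.
have q1 : q.[1] = 0.
  by rewrite /q !hornerM horner_U ?expr1n // !mul0r.
have qN1 : q.[-1] = 0.
  by rewrite /q !hornerM horner_U ?sqrrN ?expr1n // !mul0r.
have := quad_deriv sq; rewrite q1 qN1 subrr mulr0.
rewrite /q derivM legendre_ode -dlegendreS quadD -!mulrA -polyCN quadZ.
by rewrite mulNr => /eqP; rewrite addrC subr_eq0 => /eqP ->.
Qed.

(** Integrating by parts on either factor gives the same value with different eigenvalues, as
    [n (n + 1)] is injective. *)
Lemma quad_orth n n' m : (n <= d)%N -> (n' <= d)%N -> n != n' ->
  quad (U ^+ m * (y n m * y n' m)) = 0.
Proof.
move=> nd nd' nn'; apply/eqP; have := quad_by_parts m nd nd'.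
rewrite [y n m.+1 * _]mulrC quad_by_parts // [y n' m * _]mulrC => /eqP.
rewrite -subr_eq0 -mulrBl mulf_eq0 => /orP[|//].
have -> : legendre_eig n' m - legendre_eig n m = ((n' * n'.+1)%:R - (n * n.+1)%:R).
  by rewrite /legendre_eig !natrM -!natr1; ring.
rewrite subr_eq0 eqr_nat => /eqP; nia.
Qed.

Lemma quad_norm n m : (n <= d)%N -> (m <= n)%N -> quad 1 = 1 ->
  (2 * n%:R + 1) * legendre_ratio n m * quad (U ^+ m * (y n m * y n m)) = 1.
Proof.
move=> nd mn quad1.
(* The factorial ratio exactly offsets the eigenvalue in [quad_by_parts], so this quantity does not
   depend on the order; applying the rule to [unsold] then gives [2n + 1] equal terms with sum 1. *)
have J m' : (m' <= n)%N -> legendre_ratio n m' * quad (U ^+ m' * (y n m' * y n m')) =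
                          quad (U ^+ 0 * (y n 0 * y n 0)).
  elim: m' => [|m' IH] hm.
    by rewrite /legendre_ratio subn0 addn0 mulfV ?mul1r // pnatr_eq0 -lt0n fact_gt0.
  by rewrite quad_by_parts // mulrA legendre_ratioS // IH // ltnW.
rewrite -mulrA J //.
have := congr1 quad (unsold n); rewrite quad1 quadD -polyC_natr quadZ quad_sum.
rewrite (eq_bigr (fun=> quad (U ^+ 0 * (y n 0 * y n 0)))).
  rewrite sumr_const card_ord expr0 !mul1r -expr2 => h.
  by rewrite -[RHS]h -mulr_natl; ring.
by move=> [j jn] _ /=; rewrite quadZ expr2 J.
Qed.

End Quadrature.
End Legendre.

(** * Spherical harmonics *)

Section Azimuth.
Variables (R : realType) (t : nat) (alpha : R).
(** The shift [j.+1] matches ordinals from 0 with nodes numbered from 1. *)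
Let phi j : R := alpha + 2 * pi * j.+1%:R / t%:R.

(* With [delta = k pi / t], each [2 sin delta cos (k phi_j)] is a difference of
   consecutive values of a function with period [t] in [j]. *)
Lemma sum_cos_sin_phi k : (0 < k < t)%N ->
  \sum_(j < t) cos (k%:R * phi j) = 0 /\ \sum_(j < t) sin (k%:R * phi j) = 0.
Proof.
move=> /andP[k0 kt].
have t0 : (t%:R : R) != 0 by rewrite pnatr_eq0; lia.
pose delta : R := k%:R * pi / t%:R.
pose beta j : R := k%:R * alpha + (2 * j%:R + 1) * delta.
(* Since [0 < k < t], [delta] lies strictly between 0 and [pi]. *)
have sd : 2 * sin delta != 0.
  rewrite mulf_neq0 // gt_eqF // sin_gt0_pi // /delta.
  rewrite mulrAC pmulr_lgt0 ?pi_gt0 // divr_gt0 ?ltr0n //=; last by lia.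
  by rewrite gtr_pMl ?pi_gt0 // ltr_pdivrMr ?mul1r ?ltr_nat // ltr0n; lia.
have betaS j : beta j.+1 = k%:R * phi j + delta.
  by rewrite /beta /phi /delta -!natr1; field.
have betaE j : beta j = k%:R * phi j - delta.
  by rewrite /beta /phi /delta -!natr1; field.
have betat : beta t = beta 0 + (pi *+ 2) *+ k.
  by rewrite /beta /delta -mulr_natl -mulr_natl; field.
split; apply: (mulfI sd); rewrite mulr0 mulr_sumr.
- transitivity (\sum_(0 <= j < t) (sin (beta j.+1) - sin (beta j))).
    rewrite big_mkord; apply: eq_bigr => j _.
    by rewrite betaS betaE sinD sinB; ring.
  rewrite telescope_sumr // betat (periodicn (@sinD2pi R)) subrr //.
- transitivity (\sum_(0 <= j < t) (- cos (beta j.+1) - - cos (beta j))).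
    rewrite big_mkord; apply: eq_bigr => j _.
    by rewrite betaS betaE cosD cosB; ring.
  rewrite telescope_sumr // betat (periodicn (@cosD2pi R)) subrr //.
Qed.

Definition azim (m : int) (u : R) : R :=
  match m with
  | Posz 0 => 1
  | Posz m' => cos (m'%:R * u)
  | Negz m' => sin (m'.+1%:R * u)
  end.

Lemma azim_Posz (m : nat) u : azim m u = cos (m%:R * u).
Proof. by case: m => //=; rewrite mul0r cos0. Qed.

Lemma mean_cos k : (k < t)%N ->
  t%:R^-1 * (\sum_(j < t) cos (k%:R * phi j)) = (k == 0%N)%:R.
Proof.
move=> kt; case: k kt => [|k] kt; last by rewrite (proj1 (sum_cos_sin_phi _)) ?mulr0.
under eq_bigr do rewrite mul0r cos0.
by rewrite sumr_const card_ord mulVf // pnatr_eq0; lia.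
Qed.

Lemma mean_sin k : (k < t)%N ->
  t%:R^-1 * (\sum_(j < t) sin (k%:R * phi j)) = 0.
Proof.
move=> kt; case: k kt => [|k] kt; last by rewrite (proj2 (sum_cos_sin_phi _)) ?mulr0.
by under eq_bigr do rewrite mul0r sin0; rewrite big1 ?mulr0.
Qed.

(** Product to sum: the frequencies [b - a] and [a + b] are below [t], so each has mean 0 unless it
    vanishes. *)
Lemma mean_coscos a b : (a <= b)%N -> (a + b < t)%N ->
  t%:R^-1 * (\sum_(j < t) cos (a%:R * phi j) * cos (b%:R * phi j)) =
  2^-1 * ((a == b)%:R + (a + b == 0)%N%:R).
Proof.
move=> ab abt.
transitivity (2^-1 * (t%:R^-1 * (\sum_(j < t) cos ((b - a)%N%:R * phi j)) +
                     t%:R^-1 * (\sum_(j < t) cos ((a + b)%N%:R * phi j)))).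
  rewrite -mulrDr -big_split /= mulrCA; congr (_ * _); rewrite mulr_sumr.
  apply: eq_bigr => j _; rewrite natrB // natrD mulrBl mulrDl cosB cosD.
  by field.
rewrite !mean_cos; [|lia..]; congr (_ * (_%:R + _)); congr nat_of_bool; lia.
Qed.

Lemma mean_sinsin a b : (a <= b)%N -> (a + b < t)%N ->
  t%:R^-1 * (\sum_(j < t) sin (a%:R * phi j) * sin (b%:R * phi j)) =
  2^-1 * ((a == b)%:R - (a + b == 0)%N%:R).
Proof.
move=> ab abt.
transitivity (2^-1 * (t%:R^-1 * (\sum_(j < t) cos ((b - a)%N%:R * phi j)) -
                     t%:R^-1 * (\sum_(j < t) cos ((a + b)%N%:R * phi j)))).
  rewrite -mulrBr -sumrB mulrCA; congr (_ * _); rewrite mulr_sumr.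
  apply: eq_bigr => j _; rewrite natrB // natrD mulrBl mulrDl cosB cosD.
  by field.
rewrite !mean_cos; [|lia..]; congr (_ * (_%:R - _)); congr nat_of_bool; lia.
Qed.

Lemma mean_sincos a b : (a + b < t)%N ->
  t%:R^-1 * (\sum_(j < t) sin (a%:R * phi j) * cos (b%:R * phi j)) = 0.
Proof.
move=> abt.
have sinB_ : t%:R^-1 * (\sum_(j < t) sin ((a%:R - b%:R) * phi j)) = 0.
  case: (leqP a b) => ab; last by rewrite -natrB ?(ltnW ab) // mean_sin //; lia.
  rewrite -opprB -natrB //; under eq_bigr do rewrite mulNr sinN.
  by rewrite sumrN mulrN mean_sin ?oppr0 //; lia.
transitivity (2^-1 * (t%:R^-1 * (\sum_(j < t) sin ((a%:R - b%:R) * phi j)) +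
                     t%:R^-1 * (\sum_(j < t) sin ((a + b)%N%:R * phi j)))).
  rewrite -mulrDr -big_split /= mulrCA; congr (_ * _); rewrite mulr_sumr.
  apply: eq_bigr => j _; rewrite natrD mulrBl mulrDl sinB sinD.
  by field.
by rewrite sinB_ mean_sin // addr0 mulr0.
Qed.

(** Discrete orthogonality in the azimuth: the constant has mean square 1, every other factor
    1/2. *)
Lemma mean_azim (m m' : int) : (`|m| + `|m'| < t)%N ->
  t%:R^-1 * (\sum_(j < t) azim m (phi j) * azim m' (phi j)) =
  (m == m')%:R * (if m == 0 then 1 else 2^-1).
Proof.
wlog mm' : m m' / (`|m| <= `|m'|)%N.
  move=> H h; case: (leqP `|m| `|m'|) => mm'; first exact: H.
  under eq_bigr do rewrite mulrC.
  rewrite H; [|lia..]; rewrite eq_sym; case: eqP => [->//|_]; by rewrite !mul0r.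
case: m m' mm' => [a|a] [b|b] mm' h.
- under eq_bigr do rewrite !azim_Posz.
  rewrite mean_coscos; [|lia..].
  rewrite eqz_nat; case: eqP => [->|ne].
    have -> : (b + b == 0)%N = (b%:Z == 0) by lia.
    by case: (b%:Z == 0) => /=; field.
  have -> : (a + b == 0)%N = false by lia.
  by rewrite addr0 mulr0 mul0r.
- under eq_bigr do rewrite azim_Posz mulrC.
  by rewrite mean_sincos ?mul0r //; lia.
- under eq_bigr do rewrite azim_Posz.
  by rewrite mean_sincos ?mul0r //; lia.
- rewrite mean_sinsin; [|lia..].
  have -> : (a.+1 + b.+1 == 0)%N = false by lia.
  have -> : (Negz a == Negz b) = (a.+1 == b.+1) by lia.
  by rewrite subr0 mulrC.
Qed.
End Azimuth.

(** * Separation of variables, addition theorem and discrete orthonormality *)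

Section Harmonics.
Variable R : realType.

(** Order 0 is separate because [sh_const n 0] would carry an extra factor [sqrt 2]. *)
Definition sh_norm n m : R :=
  if m == 0%N then Num.sqrt (2 * n%:R + 1) else sh_const R n m.

Lemma sph_harmE n (m : int) (th ph : R) :
  sph_harm n m th ph =
  sh_norm n `|m|%N * assoc_legendre n `|m|%N (cos th) * azim m ph.
Proof.
case: m => [[|m]|m] //=.
by rewrite /sh_norm /assoc_legendre !expr0 !mul1r mulr1.
Qed.

(** The factor 1 or 1/2 is the azimuthal mean square of [mean_azim]; the right side is the constant
    of [quad_norm]. *)
Lemma sh_normE n m :
  sh_norm n m ^+ 2 * (if m == 0%N then 1 else 2^-1) = (2 * n%:R + 1) * legendre_ratio R n m.
Proof.
have n0 : 0 <= 2 * n%:R + 1 :> R by rewrite addr_ge0 // mulr_ge0.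
rewrite /sh_norm; case: eqP => [->|_].
  rewrite sqr_sqrtr // /legendre_ratio subn0 addn0 mulfV // pnatr_eq0 -lt0n fact_gt0 //.
rewrite /sh_const sqr_sqrtr; last by rewrite !mulr_ge0 // invr_ge0.
by rewrite /legendre_ratio; field; rewrite pnatr_eq0 -lt0n fact_gt0.
Qed.

(** For equal orders the square roots pair up and the signs cancel, leaving a polynomial in [x]. *)
Lemma assoc_legendreM n n' m (x : R) : -1 <= x <= 1 ->
  assoc_legendre n m x * assoc_legendre n' m x =
  ((1 - 'X ^+ 2) ^+ m * (dlegendre R n m * dlegendre R n' m)).[x].
Proof.
move=> /andP[x1 x2]; have x0 : 0 <= 1 - x ^+ 2 by nra.
rewrite /assoc_legendre !hornerM horner_exp hornerD hornerN hornerXn hornerC.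
rewrite -/(dlegendre R n m) -/(dlegendre R n' m).
rewrite -[in RHS](sqr_sqrtr x0) -exprM mulnC exprM.
set s := Num.sqrt _ ^+ m.
have -> : s ^+ 2 = ((-1) ^+ m) ^+ 2 * s ^+ 2 by rewrite sqrr_sign mul1r.
by ring.
Qed.

(** The block of degree [n] is centred at index [n^2 + n], where the order is 0. Reversing its lower
    half pairs [m.+1] with [Negz m], its opposite. *)
Lemma sum_block (F : int -> R) n :
  \sum_(n * n <= i < n.+1 * n.+1) F (i%:Z - (n * n + n)%:Z) =
  F 0 + \sum_(m < n) (F m.+1 + F (Negz m)).
Proof.
rewrite -{1}[(n * n)%N]add0n big_addn.
have -> : (n.+1 * n.+1 - n * n = n + n.+1)%N by lia.
rewrite (@big_cat_nat _ _ _ n) //=; last by rewrite leq_addr.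
have shift (G : nat -> R) :
    \sum_(n <= i < n + n.+1) G i = \sum_(0 <= i < n.+1) G (i + n)%N.
  by rewrite -{1}[n]add0n big_addn addKn.
rewrite big_nat_rev /= shift big_nat_recl // addrCA big_split /= !big_mkord.
congr (_ + _); first by congr F; lia.
rewrite addrC; congr (_ + _); apply: eq_bigr => -[i iltn] _ /=; congr F; lia.
Qed.

(** Opposite orders combine through [cos^2 + sin^2 = 1], which leaves [2n + 1] times [unsold] at
    [cos th]. *)
Lemma unsold_sph_harm n (th ph : R) :
  \sum_(n * n <= i < n.+1 * n.+1) sph_harm n (i%:Z - (n * n + n)%:Z) th ph ^+ 2 =
  2 * n%:R + 1.
Proof.
rewrite (sum_block (fun m => sph_harm n m th ph ^+ 2)).
have c1 : -1 <= cos th <= 1 by rewrite cos_geN1 cos_le1.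
have := congr1 (fun p => p.[cos th]) (unsold R n).
rewrite hornerD horner_exp hornerM horner_sum -polyC_natr !hornerC => u.
rewrite -[RHS]mulr1 -[X in _ = _ * X]u mulrDr; congr (_ + _).
  by rewrite /= exprMn sqr_sqrtr // addr_ge0 // mulr_ge0.
rewrite mulrA mulr_sumr; apply: eq_bigr => m _.
rewrite !sph_harmE azim_Posz /= !exprMn -mulrDr cos2Dsin2 mulr1.
rewrite hornerM hornerC expr2 -assoc_legendreM // -expr2.
have -> : sh_norm n m.+1 ^+ 2 = (2 * n%:R + 1) * 2 * legendre_ratio R n m.+1.
  by have := sh_normE n m.+1; rewrite /= => h; lra.
by rewrite /assoc_legendre; ring.
Qed.

(** The double sum factors. The azimuthal mean, with [|m| + |m'| <= 2d < t], kills distinct orders;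
    for equal orders the polar part is polynomial and [quad_orth] and [quad_norm] apply. *)
Lemma quad_sph_harm r (wt x : 'I_r -> R) d t alpha :
  (forall i, -1 <= x i <= 1) ->
  quad wt x 1 = 1 ->
  (forall q : {poly R}, (size q <= 2 * d + 2)%N ->
     quad wt x q^`() = 2^-1 * (q.[1] - q.[-1])) ->
  (2 * d + 1 <= t)%N ->
  forall n n' (m m' : int), (`|m|%N <= n <= d)%N -> (`|m'|%N <= n' <= d)%N ->
  \sum_(i < r) \sum_(j < t) wt i / t%:R *
     (sph_harm n m (acos (x i)) (alpha + 2 * pi * j.+1%:R / t%:R) *
      sph_harm n' m' (acos (x i)) (alpha + 2 * pi * j.+1%:R / t%:R)) =
  ((n == n') && (m == m'))%:R.
Proof.
move=> x1 quad1 quad_ibp dt n n' m m' /andP[mn nd] /andP[mn' nd'].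
have cosx i : cos (acos (x i)) = x i by rewrite acosK // in_itv /= x1.
transitivity (\sum_(i < r) wt i * (sh_norm n `|m|%N * assoc_legendre n `|m|%N (x i) *
   (sh_norm n' `|m'|%N * assoc_legendre n' `|m'|%N (x i))) *
   (t%:R^-1 * \sum_(j < t) azim m (alpha + 2 * pi * j.+1%:R / t%:R) *
              azim m' (alpha + 2 * pi * j.+1%:R / t%:R))).
  apply: eq_bigr => i _; rewrite mulr_sumr mulr_sumr; apply: eq_bigr => j _.
  by rewrite !sph_harmE cosx; ring.
rewrite mean_azim; last by lia.
case: eqP => [<-|_]; last by rewrite andbF mul0r big1 // => i _; rewrite mulr0.
rewrite andbT mul1r.
transitivity (sh_norm n `|m|%N * sh_norm n' `|m|%N * (if m == 0 then 1 else 2^-1) *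
   quad wt x ((1 - 'X ^+ 2) ^+ `|m|%N * (dlegendre R n `|m|%N * dlegendre R n' `|m|%N))).
  rewrite /quad mulr_sumr; apply: eq_bigr => i _.
  by rewrite -assoc_legendreM //; ring.
case: (eqVneq n n') => [<-|nn']; last first.
  by rewrite (quad_orth quad_ibp) // mulr0.
rewrite -expr2 -absz_eq0 sh_normE (quad_norm quad_ibp) //.
Qed.

Lemma sh_degE n i : (n * n <= i < n.+1 * n.+1)%N -> sh_deg i = n.
Proof.
move=> /andP[h1 h2]; apply/eqP; rewrite eqn_leq; apply/andP; split.
  by apply/bigmax_leqP => k hk; nia.
have ni : (n < i.+1)%N by nia.
exact: (@leq_bigmax_cond _ (fun k : 'I_i.+1 => (k * k <= i)%N) val (Ordinal ni) h1).
Qed.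

Lemma sh_degP i : (sh_deg i * sh_deg i <= i < (sh_deg i).+1 * (sh_deg i).+1)%N.
Proof.
apply/andP; split.
  rewrite /sh_deg; elim/big_ind: _ => //= a b ha hb.
  by rewrite /maxn; case: ifP.
rewrite ltnNge; apply/negP => h.
have hi : ((sh_deg i).+1 < i.+1)%N by nia.
have := @leq_bigmax_cond _ (fun n : 'I_i.+1 => (n * n <= i)%N) val (Ordinal hi) h.
by rewrite -/(sh_deg i) /= ltnn.
Qed.

Lemma sh_ord_le i : (`|sh_ord i| <= sh_deg i)%N.
Proof. have := sh_degP i; rewrite /sh_ord; lia. Qed.

Lemma sh_deg_ord_inj i j : sh_deg i = sh_deg j -> sh_ord i = sh_ord j -> i = j.
Proof. by rewrite /sh_ord => ->; lia. Qed.

Lemma sh_deg_le d (i : 'I_((d + 1) ^ 2)) : (sh_deg i <= d)%N.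
Proof. by case: i => i /=; have := sh_degP i; rewrite expnS expn1; nia. Qed.

Lemma sum_sh_deg d n (F : nat -> R) : (n <= d)%N ->
  \sum_(i < (d + 1) ^ 2 | sh_deg i == n) F i = \sum_(n * n <= i < n.+1 * n.+1) F i.
Proof.
move=> nd.
rewrite -(big_mkord (fun i => sh_deg i == n)).
have h : (n.+1 * n.+1 <= (d + 1) ^ 2)%N by rewrite expnS expn1; nia.
rewrite (@big_cat_nat _ _ _ (n * n)) //=; last by apply: leq_trans h; nia.
rewrite (@big_cat_nat _ _ _ (n.+1 * n.+1) (n * n)) //=; last by nia.
rewrite big_nat_cond big1 ?add0r; last first.
  move=> i; case/andP=> /andP[_ h1] /eqP e; have := sh_degP i; rewrite e; lia.
rewrite [X in _ + X]big_nat_cond [X in _ + X]big1 ?addr0; last first.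
  move=> i; case/andP=> /andP[h1 _] /eqP e; have := sh_degP i; rewrite e; lia.
rewrite big_nat_cond [RHS]big_nat_cond; apply: eq_bigl => i.
rewrite andbT; case h1 : (_ <= _ < _)%N => //=; apply/eqP; exact: sh_degE.
Qed.

Lemma unsold_fvec d n (x : R * R) : (n <= d)%N ->
  \sum_(i < (d + 1) ^ 2 | sh_deg i == n) fvec i x ^+ 2 = 2 * n%:R + 1.
Proof.
move=> nd; rewrite -(unsold_sph_harm n x.1 x.2).
rewrite (sum_sh_deg (fun i => sph_harm (sh_deg i) (sh_ord i) x.1 x.2 ^+ 2) nd).
rewrite big_nat_cond [RHS]big_nat_cond; apply: eq_bigr => i; rewrite andbT => hi.
by rewrite /sh_ord (sh_degE hi).
Qed.

End Harmonics.

(** * Information matrices *)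

Section Quadrature_rule.
Variable R : realType.
Local Notation leb := (@lebesgue_measure R).

Lemma set_itv_N11 : [set y : R | -1 <= y <= 1] = `[-1, 1]%classic.
Proof. by apply/seteqP; split => y /=; rewrite in_itv. Qed.

Lemma Rintegral_deriv_poly (q : {poly R}) :
  Rintegral leb [set y : R | -1 <= y <= 1] (fun y => q^`().[y]) = q.[1] - q.[-1].
Proof.
rewrite set_itv_N11 /Rintegral (@continuous_FTC2 _ _ (horner q)) //.
- by apply: continuous_subspaceT; exact: continuous_horner.
- split => [z _||].
  + exact: derivable_horner.
  + by apply: cvg_at_right_filter; exact: continuous_horner.
  + by apply: cvg_at_left_filter; exact: continuous_horner.
- by move=> z _; rewrite -derivE.
Qed.

(** By linearity it suffices to treat monomials of degree at most [2d + 1], whose derivatives are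
    multiples of the powers integrated exactly. *)
Lemma quad_deriv_poly r (w x : 'I_r -> R) d :
  (forall l : nat, (l <= 2 * d)%N -> \sum_i w i * x i ^+ l =
     2^-1 * Rintegral leb [set y : R | -1 <= y <= 1] (fun y => y ^+ l)) ->
  forall q : {poly R}, (size q <= 2 * d + 2)%N ->
    quad w x q^`() = 2^-1 * (q.[1] - q.[-1]).
Proof.
move=> wx q sq.
have mono l : (l <= 2 * d + 1)%N ->
    quad w x ('X^l)^`() = 2^-1 * (('X^l).[1] - ('X^l).[-1]).
  case: l => [|l] hl.
    rewrite expr0 deriv_one !hornerC subrr mulr0 /quad big1 // => i _.
    by rewrite horner0 mulr0.
  rewrite -Rintegral_deriv_poly.
  have -> : (fun y : R => ('X^(l.+1))^`().[y]) = (fun y => l.+1%:R * y ^+ l).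
    by apply/funext => y; rewrite derivXn hornerMn hornerXn mulr_natl.
  have ll : (l <= 2 * d)%N by lia.
  have -> : Rintegral leb [set y : R | -1 <= y <= 1] (fun y => l.+1%:R * y ^+ l) =
      l.+1%:R * Rintegral leb [set y : R | -1 <= y <= 1] (fun y => y ^+ l).
    apply: RintegralZl; rewrite set_itv_N11 //.
    apply: continuous_compact_integrable; first exact: segment_compact.
    by apply: continuous_subspaceT; exact: exprn_continuous.
  rewrite mulrCA -wx // /quad mulr_sumr; apply: eq_bigr => i _.
  by rewrite derivXn hornerMn hornerXn -mulr_natl; ring.
rewrite -[q]coefK poly_def raddf_sum /= quad_sum horner_sum horner_sum.
rewrite -sumrB mulr_sumr; apply: eq_bigr => i _.
rewrite -mul_polyC derivM derivC mul0r add0r quadZ mono; last first.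
  by have := leq_trans (ltn_ord i) sq; rewrite addn2 addn1.
by rewrite !hornerM !hornerC; ring.
Qed.
End Quadrature_rule.

(** * Finitely supported measures *)

Section Discrete.
Local Open Scope ereal_scope.
Context d (T : measurableType d) (R : realType).

(** Adding one atom at a time carries the integration formula along; the factor [\d_(c.2) D]
    discards atoms outside [D]. *)
Lemma discrete_measure (s : seq ({nonneg R} * T)) :
  exists m : {measure set T -> \bar R},
    (forall A, m A = \sum_(c <- s) c.1%:num%:E * \d_(c.2) A) /\
    forall (D : set T) (f : T -> \bar R), measurable D -> measurable_fun D f ->
      (forall x, D x -> 0 <= f x) ->
      \int[m]_(x in D) f x = \sum_(c <- s) c.1%:num%:E * (\d_(c.2) D * f c.2).
Proof.
elim: s => [|[c a] s [m [mE mI]]].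
  exists mzero; split => [A|D f mD mf f0]; rewrite big_nil //.
  by rewrite integral_measure_zero.
exists (measure_add (mscale c (dirac a)) m); split => [A|D f mD mf f0].
  by rewrite big_cons -mE; exact: measure_addE.
rewrite ge0_integral_measure_add // big_cons mI // ge0_integral_mscale //.
by rewrite integral_dirac.
Qed.

End Discrete.

(** * Information matrices of arbitrary designs, and optimality of the identity *)

Section Design.
Variable R : realType.
Local Notation D := (@design_space R).

Lemma measurable_design_space : measurable D.
Proof.
have -> : D = `[0, pi]%classic `*` `]- pi, pi]%classic.
  by apply/seteqP; split => -[a b] /=; rewrite !in_itv.
exact: measurableX.
Qed.

Lemma measurable_fvec d (i : 'I_((d + 1) ^ 2)) : measurable_fun setT (@fvec R d i).
Proof.
rewrite /fvec; set n := sh_deg i; set m := sh_ord i.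
have -> : (fun x : R * R => sph_harm n m x.1 x.2) =
    (fun x => sh_norm R n `|m|%N * (-1) ^+ `|m|%N *
       (((fun th => Num.sqrt (1 - cos th ^+ 2) ^+ `|m|%N *
                    (dlegendre R n `|m|).[cos th]) \o fst) x *
        (azim m \o snd) x)).
  by apply/funext => x; rewrite sph_harmE /assoc_legendre /=; rewrite !mulrA.
apply: measurable_funM; first exact: measurable_cst.
apply: measurable_funM; apply: measurableT_comp => //.
- apply: measurable_funM.
    apply: measurable_funX; apply: measurableT_comp.
      by apply: continuous_measurable_fun; exact: sqrt_continuous.
    apply: measurable_funB => //; apply: measurable_funX.
    by apply: continuous_measurable_fun; exact: continuous_cos.
  apply: measurableT_comp; apply: continuous_measurable_fun.
    exact: continuous_horner.
  exact: continuous_cos.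
- apply: continuous_measurable_fun; case: m => [[|m]|m] /=.
  + exact: cst_continuous.
  + move=> u; apply: continuous_comp; last exact: continuous_cos.
    by apply: mulrl_continuous.
  + move=> u; apply: continuous_comp; last exact: continuous_sin.
    by apply: mulrl_continuous.
Qed.

(** One term of the addition theorem is at most the whole sum; this boundedness makes all entries of
    the information matrix integrable. *)
Lemma fvec_sqr_le d (i : 'I_((d + 1) ^ 2)) (x : R * R) :
  fvec i x ^+ 2 <= 2 * d%:R + 1.
Proof.
have nd := sh_deg_le i.
apply: (@le_trans _ _ (2 * (sh_deg i)%:R + 1)); last first.
  by rewrite lerD2r ler_pM2l // ler_nat.
rewrite -(unsold_fvec x nd) (bigD1 i) //= lerDl sumr_ge0 // => j _.
exact: sqr_ge0.
Qed.

Lemma fvecM_le d (i j : 'I_((d + 1) ^ 2)) (x : R * R) :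
  `|fvec i x * fvec j x| <= 2 * d%:R + 1.
Proof.
have := fvec_sqr_le i x; have := fvec_sqr_le j x.
move: (fvec i x) (fvec j x) => a b hb ha.
rewrite ler_norml; nra.
Qed.

Lemma measurable_fvecM d (i j : 'I_((d + 1) ^ 2)) :
  measurable_fun setT (fun x : R * R => fvec i x * fvec j x).
Proof. by apply: measurable_funM; exact: measurable_fvec. Qed.

Section General_design.
Variables (Q : probability (R * R)%type R) (Qd : is_design Q).

Lemma integrable_fvecM d (i j : 'I_((d + 1) ^ 2)) :
  Q.-integrable D (EFin \o (fun x => fvec i x * fvec j x)).
Proof.
apply: measurable_bounded_integrable.
- exact: measurable_design_space.
- by apply: le_lt_trans (probability_le1 _ measurable_design_space) _; exact: ltry.
- by apply: measurable_funTS; exact: measurable_fvecM.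
- exists (2 * d%:R + 1); split; first exact: num_real.
  move=> M /ltW MM x _ /=; apply: le_trans MM; exact: fvecM_le.
Qed.

Lemma Rintegral_lincomb (I : Type) (s : seq I) (c : I -> R) (g : I -> R * R -> R) :
  (forall k, Q.-integrable D (EFin \o g k)) ->
  Rintegral Q D (fun x => \sum_(k <- s) c k * g k x) =
  \sum_(k <- s) c k * Rintegral Q D (g k).
Proof.
move=> ig; have mD := measurable_design_space.
have icg k : Q.-integrable D (EFin \o (fun x => c k * g k x)).
  by apply: (integrableZl mD (c k) (ig k)).
elim: s => [|k s IH].
  rewrite big_nil (_ : (fun x => _) = cst 0) ?Rintegral_cst ?mul0r //.
  by apply/funext => x; rewrite big_nil.
have -> : (fun x => \sum_(k <- k :: s) c k * g k x) =
          (fun x => c k * g k x + \sum_(k <- s) c k * g k x).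
  by apply/funext => x; rewrite big_cons.
rewrite RintegralD // ?RintegralZl // ?IH ?big_cons //.
rewrite (_ : _ \o _ = (fun x => \sum_(k <- s) (c k * g k x)%:E)%E); last first.
  by apply/funext => x /=; rewrite sumEFin.
by apply: (@integrable_sum _ _ _ _ _ mD _ _ _ (fun k x => (c k * g k x)%:E)) => k' _; exact: icg.
Qed.

Lemma info_mx_sym d : (info_mx d Q)^T = info_mx d Q.
Proof.
apply/matrixP => i j; rewrite !mxE; congr Rintegral.
by apply/funext => x; rewrite mulrC.
Qed.

(** The form at [v] is the integral of the square of the linear combination of the [fvec i] with
    coefficients [v]. *)
Lemma info_mx_psd d : psd (info_mx d Q).
Proof.
move=> v.
have -> : (v *m info_mx d Q *m v^T) 0 0 =
    \sum_(k : 'I_((d + 1) ^ 2) * 'I_((d + 1) ^ 2)) (v 0 k.1 * v 0 k.2) *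
      Rintegral Q D (fun x => fvec k.1 x * fvec k.2 x).
  rewrite mxE -(pair_bigA _ (fun i j => (v 0 i * v 0 j) *
      Rintegral Q D (fun x => fvec i x * fvec j x))) /= exchange_big /=.
  apply: eq_bigr => j _; rewrite !mxE mulr_suml; apply: eq_bigr => i _.
  by rewrite !mxE mulrAC.
rewrite -Rintegral_lincomb; last by move=> k; exact: integrable_fvecM.
apply: Rintegral_ge0 => x _.
have -> : \sum_(k : 'I_((d + 1) ^ 2) * 'I_((d + 1) ^ 2)) (v 0 k.1 * v 0 k.2) *
      (fvec k.1 x * fvec k.2 x) = (\sum_i v 0 i * fvec i x) ^+ 2.
  rewrite -(pair_bigA _ (fun i j => (v 0 i * v 0 j) * (fvec i x * fvec j x))) /=.
  rewrite expr2 mulr_suml; apply: eq_bigr => i _; rewrite mulr_sumr.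
  by apply: eq_bigr => j _; rewrite mulrACA.
exact: sqr_ge0.
Qed.

(** The summed integrand is the constant [2n + 1], the size of the block of degree [n], and the
    design has total mass 1. *)
Lemma sum_diag_info_mx_deg d n : (n <= d)%N ->
  \sum_(i < (d + 1) ^ 2 | sh_deg i == n) (info_mx d Q i i - 1) = 0.
Proof.
move=> nd; rewrite sumrB (sum_sh_deg (fun=> 1) nd).
rewrite sumr_const_nat.
have -> : (n.+1 * n.+1 - n * n = 2 * n + 1)%N by nia.
rewrite natrD natrM; apply/eqP; rewrite subr_eq0; apply/eqP.
under eq_bigr do rewrite mxE -[Rintegral _ _ _]mul1r.
rewrite -big_filter -Rintegral_lincomb; last by move=> k; exact: integrable_fvecM.
rewrite (_ : (fun x => _) = cst (2 * n%:R + 1)).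
  rewrite (Rintegral_cst _ measurable_design_space) [X in _ * X](_ : _ = 1) ?mulr1 //.
  exact: (congr1 fine Qd).
apply/funext => x; rewrite big_filter -(unsold_fvec x nd).
by apply: eq_bigr => i _; rewrite mul1r.
Qed.

Lemma sum_diag_info_mx d (S : pred nat) :
  \sum_(i < (d + 1) ^ 2 | S (sh_deg i)) (info_mx d Q i i - 1) = 0.
Proof.
(* [S] looks at degrees only, so it takes or drops whole blocks; [inord] is faithful here since
   degrees are at most [d]. *)
rewrite (partition_big (fun i : 'I_((d + 1) ^ 2) => inord (sh_deg i) : 'I_d.+1) predT) //=.
apply: big1 => n _.
have nd : (n <= d)%N by rewrite -ltnS.
case Sn : (S n).
  rewrite -[RHS](sum_diag_info_mx_deg nd); apply: eq_bigl => i.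
  rewrite -val_eqE /= inordK ?ltnS ?sh_deg_le //.
  by case: eqP => [->|]; rewrite ?Sn ?andbF.
rewrite big_pred0 // => i; rewrite -val_eqE /= inordK ?ltnS ?sh_deg_le //.
by apply/negbTE/negP => /andP[Si /eqP e]; rewrite e Sn in Si.
Qed.

Lemma tr_info_mx d : \tr (info_mx d Q) = ((d + 1) ^ 2)%:R.
Proof.
have := sum_diag_info_mx d predT; rewrite sumrB sumr_const card_ord.
by move/eqP; rewrite subr_eq0 => /eqP.
Qed.

End General_design.

(** The [nth] in [sel_mx] takes the row index as default; [j] is in range, so [tnth] removes this
    dependence. *)
Lemma sel_mx_delta d (S : pred nat) (j : 'I_(size (sel_idx d S))) i :
  sel_mx R d S i j = (i == tnth (in_tuple (sel_idx d S)) j)%:R.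
Proof. by rewrite mxE (tnth_nth i). Qed.

Lemma sel_mx_orth d (S : pred nat) : (sel_mx R d S)^T *m sel_mx R d S = 1%:M.
Proof.
apply/matrixP => j j'; rewrite mxE.
under eq_bigr do rewrite mxE !sel_mx_delta.
rewrite (bigD1 (tnth (in_tuple (sel_idx d S)) j)) //= eqxx mul1r.
rewrite big1 ?addr0 => [|i /negbTE ->]; last by rewrite mul0r.
rewrite mxE; congr (nat_of_bool _)%:R; apply/eqP/eqP => [|->] //.
by move/tuple_uniqP; apply; rewrite filter_uniq // enum_uniq.
Qed.

Lemma tr_sel_mx d (S : pred nat) (M : 'M[R]_((d + 1) ^ 2)) :
  \tr ((sel_mx R d S)^T *m M *m sel_mx R d S) =
  \sum_(i < (d + 1) ^ 2 | S (sh_deg i)) M i i.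
Proof.
transitivity (\sum_(i <- sel_idx d S) M i i); last first.
  by rewrite big_filter big_enum_cond.
rewrite [RHS]big_tnth; apply: eq_bigr => j _.
have kE i : sel_mx R d S i j = (i == tnth (in_tuple (sel_idx d S)) j)%:R.
  exact: sel_mx_delta.
rewrite mxE (bigD1 (tnth (in_tuple (sel_idx d S)) j)) //= kE eqxx mulr1.
rewrite [X in _ + X]big1 ?addr0 => [|i /negbTE ij]; last by rewrite kE ij mulr0.
rewrite mxE (bigD1 (tnth (in_tuple (sel_idx d S)) j)) //= mxE kE eqxx mul1r.
rewrite [X in _ + X]big1 ?addr0 // => i /negbTE ij.
by rewrite mxE kE ij mul0r.
Qed.

Lemma tr_sel_info_mx d (S : pred nat) (Q : probability (R * R)%type R) :
  is_design Q ->
  \tr ((sel_mx R d S)^T *m info_mx d Q *m sel_mx R d S) =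
  (size (sel_idx d S))%:R.
Proof.
move=> Qd; rewrite tr_sel_mx.
have := sum_diag_info_mx Qd d S; rewrite sumrB => /eqP; rewrite subr_eq0 => /eqP ->.
by rewrite -sum1_size natr_sum /= big_filter big_enum_cond.
Qed.

Lemma Psi_optimal_of_id (p : \bar R) d r (P : probability (R * R)%type R) :
  (p < 1%:E)%E -> (1 <= r <= (d + 1) ^ 2)%N ->
  is_design P -> info_mx d P = 1%:M -> Psi_optimal p r d P.
Proof.
move=> p1 rd Pd P1; split; first exact: Pd.
move=> Q Qd; rewrite P1.
apply: Psi_crit_le1 => //; [exact: info_mx_sym|exact: info_mx_psd|].
by rewrite tr_info_mx.
Qed.

(** At the identity [CK] is the identity too, as [sel_mx] has orthonormal columns; for a competitor,
    [CK_spec] bounds the trace of [CK] by the number of selected coefficients. *)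
Lemma Phi_optimal_of_id (p : \bar R) d S (P : probability (R * R)%type R) :
  (p < 1%:E)%E ->
  is_design P -> info_mx d P = 1%:M -> Phi_optimal p d S P.
Proof.
move=> p1 Pd P1; split; first exact: Pd.
rewrite P1; split.
  by rewrite /estimable trmx1 submx1.
move=> Q Qd eQ.
have -> : CK (sel_mx R d S) 1%:M = 1%:M.
  by rewrite /CK pinvmxE ?unitmx1 // invmx1 mulmx1 sel_mx_orth invmx1.
have pQ : psd (info_mx d Q) by exact: info_mx_psd.
have [sC pC uC tC] := CK_spec (info_mx_sym Q d) pQ (sel_mx_orth d S) eQ.
by apply: Phi_crit_le1 => //; rewrite -(tr_sel_info_mx d S Qd).
Qed.

End Design.

(** * Integration against the product design *)

Section Product_design.
Variables (R : realType) (d r t : nat) (x w : 'I_r -> R) (alpha : R).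
Variable P : probability (R * R)%type R.
Hypotheses (x1 : forall i, -1 <= x i <= 1) (w0 : forall i, 0 < w i).
Hypothesis w1 : \sum_i w i = 1.
Hypothesis t0 : (0 < t)%N.
Hypothesis alphaE : - ((t%:R + 1) / t%:R) * pi < alpha <= - pi.
Let pt i (j : 'I_t) : R * R := (acos (x i), alpha + 2 * pi * j.+1%:R / t%:R).
Hypothesis PE : forall A : set (R * R), measurable A ->
     P A = (\sum_(i < r) \sum_(j < t) ((w i / t%:R)%:E * \d_(pt i j) A))%E.
Local Notation D := (@design_space R).

(** The lower bound on [alpha] gives [alpha + 2 pi / t > - pi], and [alpha <= - pi] keeps the last
    azimuth [alpha + 2 pi] at most [pi]. *)
Lemma pt_design i j : D (pt i j).
Proof.
rewrite /pt /design_space /=; split.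
  by rewrite acos_ge0 ?acos_lepi.
have t0' : 0 < t%:R :> R by rewrite ltr0n.
have pi0 := @pi_gt0 R.
have j1 : 1 <= j.+1%:R :> R by rewrite ler1n.
have jt : j.+1%:R <= t%:R :> R by rewrite ler_nat ltn_ord.
move/andP: alphaE => [a1 a2].
have e1 : - ((t%:R + 1) / t%:R) * pi = - pi - pi / t%:R :> R.
  by field; rewrite gt_eqF.
rewrite e1 in a1.
have e2 : 2 * pi * j.+1%:R / t%:R = 2 * j.+1%:R * (pi / t%:R) :> R by field; rewrite gt_eqF.
have e3 : t%:R * (pi / t%:R) = pi :> R by field; rewrite gt_eqF.
have q0 : 0 < pi / t%:R :> R by rewrite divr_gt0.
rewrite e2; move: (pi / t%:R) q0 a1 e3 => q q0 a1 e3.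
apply/andP; split; nra.
Qed.

Let weight_ge0 i : 0 <= w i / t%:R.
Proof. by rewrite divr_ge0 // ltW. Qed.

Let sum_weight : \sum_(i < r) \sum_(j < t) w i / t%:R = 1.
Proof.
rewrite -[RHS]w1; apply: eq_bigr => i _.
by rewrite sumr_const card_ord -(mulr_natr (w i / t%:R)) divfK // pnatr_eq0 -lt0n.
Qed.

Lemma is_design_product : is_design P.
Proof.
rewrite /is_design PE; last exact: measurable_design_space.
rewrite -[RHS]/(1%:E) -[in RHS]sum_weight -sumEFin; apply: eq_bigr => i _.
rewrite -sumEFin; apply: eq_bigr => j _.
by rewrite diracE mem_set ?mule1 //; exact: pt_design.
Qed.

(** [P] is known only through its values on measurable sets, so it is exchanged for an explicit sum
    of point masses with the same values. *)
Lemma integral_product (f : R * R -> \bar R) : measurable_fun setT f ->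
  (forall z, 0 <= f z)%E ->
  (\int[P]_(z in D) f z =
   \sum_(i < r) \sum_(j < t) (w i / t%:R)%:E * f (pt i j))%E.
Proof.
move=> mf f0.
pose s := [seq (NngNum (weight_ge0 i), pt i j) | i <- enum 'I_r, j <- enum 'I_t].
have [m [mE mI]] := discrete_measure s.
rewrite (@eq_measure_integral _ _ _ D m); last first.
  move=> A mA _; rewrite mE; apply: etrans; first exact: PE.
  rewrite big_allpairs_dep big_enum; apply: eq_bigr => i _.
  by rewrite big_enum.
rewrite mI //; last by apply: measurable_funTS.
  rewrite big_allpairs_dep big_enum; apply: eq_bigr => i _.
  rewrite big_enum; apply: eq_bigr => j _ /=.
  by rewrite diracE mem_set ?mul1e //; exact: pt_design.
exact: measurable_design_space.
Qed.

(** Adding the bound [C] makes the integrand nonnegative; its contribution cancels since both sides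
    have total mass 1. *)
Lemma Rintegral_product (g : R * R -> R) (C : R) : measurable_fun setT g ->
  (forall z, `|g z| <= C) ->
  Rintegral P D g = \sum_(i < r) \sum_(j < t) w i / t%:R * g (pt i j).
Proof.
move=> mg gC.
have mD : measurable D := @measurable_design_space R.
have ig : P.-integrable D (EFin \o g).
  apply: measurable_bounded_integrable => //.
  - by apply: le_lt_trans (probability_le1 _ mD) _; exact: ltry.
  - exact: measurable_funTS.
  - exists C; split; first exact: num_real.
    by move=> M /ltW MM z _ /=; apply: le_trans MM.
have ic : P.-integrable D (EFin \o cst C).
  apply: measurable_bounded_integrable => //.
  - by apply: le_lt_trans (probability_le1 _ mD) _; exact: ltry.
  - exists `|C|; split; first exact: num_real.
    by move=> M /ltW MM z _ /=; apply: le_trans MM.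
have h : Rintegral P D (fun z => g z + C) =
    \sum_(i < r) \sum_(j < t) w i / t%:R * (g (pt i j) + C).
  rewrite /Rintegral integral_product; last 2 first.
  - by apply/measurable_EFinP; apply: measurable_funD.
  - by move=> z; rewrite lee_fin; have := gC z; rewrite ler_norml => /andP[]; lra.
  under eq_bigr do [under eq_bigr do rewrite -EFinM; rewrite sumEFin].
  by rewrite sumEFin.
move: h; rewrite (RintegralD mD ig ic) (Rintegral_cst _ mD).
rewrite [X in C * X](_ : _ = 1); last exact: (congr1 fine is_design_product).
have -> : \sum_(i < r) \sum_(j < t) w i / t%:R * (g (pt i j) + C) =
    \sum_(i < r) \sum_(j < t) w i / t%:R * g (pt i j) + C * 1.
  rewrite -[X in C * X]sum_weight mulr_sumr -big_split /=; apply: eq_bigr => i _.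
  rewrite mulr_sumr -big_split /=; apply: eq_bigr => j _.
  by rewrite mulrDr [C * _]mulrC.
exact: addIr.
Qed.

Hypothesis quad_exact : forall l : nat, (l <= 2 * d)%N ->
  \sum_i w i * x i ^+ l =
  2^-1 * Rintegral (@lebesgue_measure R) [set y : R | -1 <= y <= 1]
                   (fun y => y ^+ l).
Hypothesis dt : (2 * d + 1 <= t)%N.

(** Each entry is a sum evaluated by [quad_sph_harm], and degree and order together determine the
    index. *)
Lemma info_mx_product : info_mx d P = 1%:M.
Proof.
have quad1 : quad w x 1 = 1.
  by rewrite -[RHS]w1; apply: eq_bigr => i _; rewrite hornerC mulr1.
apply/matrixP => i j; rewrite !mxE.
rewrite (Rintegral_product (@measurable_fvecM _ _ _ _) (fvecM_le i j)).
rewrite (quad_sph_harm alpha x1 quad1 (quad_deriv_poly quad_exact) dt);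
  [|by rewrite sh_ord_le sh_deg_le..].
congr (nat_of_bool _)%:R; apply/andP/eqP => [[/eqP e1 /eqP e2]|->]; last by rewrite !eqxx.
by apply: val_inj; exact: sh_deg_ord_inj.
Qed.

End Product_design.

Theorem theorem3p2 (R : realType) (d : nat) (p : \bar R) (q : nat)
  (k : 'I_q.+1 -> nat) (r : nat) (x w : 'I_r -> R) (t : nat) (alpha : R)
  (P : probability (R * R)%type R) :
  (0 < d)%N ->
  (p < 1%:E)%E ->
  (forall l1 l2 : 'I_q.+1, (l1 < l2)%N -> (k l1 < k l2)%N) ->
  (forall l, (k l <= d)%N) ->
  (d.+1 <= r <= 2 * d)%N ->
  (forall i j : 'I_r, (i < j)%N -> x i < x j) ->
  (forall i, -1 <= x i <= 1) ->
  (forall i, 0 < w i) ->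
  \sum_i w i = 1 ->
  (forall l : nat, (l <= 2 * d)%N ->
     \sum_i w i * x i ^+ l =
     2^-1 * Rintegral (@lebesgue_measure R) [set y : R | -1 <= y <= 1]
                      (fun y => y ^+ l)) ->
  (2 * d + 1 <= t)%N ->
  - ((t%:R + 1) / t%:R) * pi < alpha <= - pi ->
  (* P is the product design mu (x) nu *)
  (forall A : set (R * R), measurable A ->
     P A = (\sum_(i < r) \sum_(j < t)
              ((w i / t%:R)%:E
               * \d_((acos (x i), alpha + 2 * pi * j.+1%:R / t%:R)%R) A))%E) ->
  Phi_optimal p d [pred n | n \in [seq k l | l <- enum 'I_q.+1]] P /\
  (forall r' : nat, (1 <= r' <= (d + 1) ^ 2)%N -> Psi_optimal p r' d P).
Proof.
move=> _ p1 _ _ _ _ x1 w0 w1 quad_exact dt alphaE PE.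
have t0 : (0 < t)%N by apply: leq_trans dt; rewrite addn1.
have Pd := is_design_product x1 w1 t0 alphaE PE.
have P1 := info_mx_product x1 w0 w1 t0 alphaE PE quad_exact dt.
split; first exact: Phi_optimal_of_id.
by move=> r' hr'; exact: Psi_optimal_of_id.
Qed.
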